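(* Let $D\in\mathbb{K}^{N\times N}$ be the total boundary matrix of a filtered chain complex $C$ over a field $\mathbb{K}$, and let $\mathcal{R}M=D\mathcal{C}$ be a U-match decomposition with $\mathcal{R}$ and $\mathcal{C}$ both 0-graded. Let $Y$ be the right-reduction $(\mathcal{R}M)=D\,\mathcal{C}$ of $D$. Then for every element $W$ of the saecular lattice $\mathscr{S}$ of $C$, some subset of the columns of $\mathscr{E}_Y$ is a basis of $W$.
   Context: Filtered complex: $C$ is a finite-dimensional chain complex over $\mathbb{K}$ with an ordered basis of homogeneous chains $\sigma_1,\dots,\sigma_N$, with $\sigma_i$ of dimension $\dim(\sigma_i)$, such that $F_pC=\mathrm{span}\{\sigma_1,\dots,\sigma_p\}$ is a subcomplex for each $p=0,\dots,N$ and $\partial\sigma_p=\sum_{q<p}D[q,p]\sigma_q$. Thus $D$ is strictly upper triangular, $D^2=0$, and $D[i,j]\ne0$ implies $\dim(\sigma_i)=\dim(\sigma_j)-1$. Identify $C$ with $\mathbb{K}^N$ via this basis. $F_pC_n$ denotes the subspace of $n$-dimensional chains in $F_pC$. A matrix $E\in\mathbb{K}^{N\times N}$ is 0-graded if $E[i,j]\neq 0$ implies $\dim(\sigma_i)=\dim(\sigma_j)$. A (generalized) matching matrix has at most one nonzero entry in each row and each column. A U-match decomposition of $D\in\mathbb{K}^{N\times N}$ is a tuple $(\mathcal{R},M,D,\mathcal{C})$ with $\mathcal{R}M=D\mathcal{C}$, $M$ a matching matrix, and $\mathcal{R},\mathcal{C}$ upper unitriangular (upper triangular with ones on the diagonal).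 A right-reduction of $D$ is a triple $Y=(R,D,V)$ with $R=DV$, $V$ invertible upper triangular, and $R$ reduced: writing $\mathrm{low}_R(c)=\max\{r: R[r,c]\ne0\}$ for each nonzero column $c$, one has $\mathrm{low}_R(c)\neq\mathrm{low}_R(c')$ for distinct nonzero columns. $\mathscr{E}_Y$ is the matrix with $\mathrm{col}_j(\mathscr{E}_Y)=\mathrm{col}_i(R)$ if $j=\mathrm{low}_R(i)$ for some $i$, and $\mathrm{col}_j(\mathscr{E}_Y)=\mathrm{col}_j(V)$ otherwise. (Here $R=\mathcal{R}M$ and $V=\mathcal{C}$.) The saecular lattice $\mathscr{S}$ is the sublattice (closed under sum and intersection) of the lattice of linear subspaces of $C$ generated by all subspaces of the form $F_pC_n$, $D_\bullet(F_pC_n)=\{Dv: v\in F_pC_n\}$, and $D^\bullet(F_pC_n)=\{v\in C: Dv\in F_pC_n\}$, over all $n$ and $p\ge0$ (with $F_0C=0$). *)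

(* Defs.v *)
From HB Require Import structures.
From mathcomp Require Import all_boot all_order all_algebra.

Set Implicit Arguments.
Unset Strict Implicit.
Unset Printing Implicit Defensive.

Import Order.TTheory GRing.Theory Num.Theory.
Local Open Scope ring_scope.

(** The complex is identified with ['cV[K]_N] through its ordered basis of
    chains; indices are 0-based, so sigma_(i+1) is [delta_mx i 0], of dimension
    [sdim i].  Dimensions are integers: negative degrees are allowed. *)
Record filteredComplex (K : fieldType) (N : nat) := FilteredComplex {
  sdim : 'I_N -> int;
  bd : 'M[K]_N;
  bd_strict_upper : forall i j : 'I_N, (j <= i)%N -> bd i j = 0;
  bd_sq0 : bd *m bd = 0;
  bd_deg : forall i j : 'I_N, bd i j != 0 -> sdim i = sdim j - 1
}.

Definition zero_graded (K : fieldType) (N : nat) (d : 'I_N -> int)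
    (E : 'M[K]_N) : Prop :=
  forall i j : 'I_N, E i j != 0 -> d i = d j.

Definition matching_mx (K : fieldType) (N : nat) (M : 'M[K]_N) : Prop :=
  (forall i j j' : 'I_N, M i j != 0 -> M i j' != 0 -> j = j') /\
  (forall i i' j : 'I_N, M i j != 0 -> M i' j != 0 -> i = i').

(* [is_trig_mx] is lower triangularity, hence the transpose. *)
Definition upper_trig (K : fieldType) (N : nat) (A : 'M[K]_N) : Prop :=
  is_trig_mx A^T.

Definition upper_unitrig (K : fieldType) (N : nat) (A : 'M[K]_N) : Prop :=
  upper_trig A /\ (forall i : 'I_N, A i i = 1).

Record umatch (K : fieldType) (N : nat) (D : 'M[K]_N) := UMatch {
  um_R : 'M[K]_N;
  um_M : 'M[K]_N;
  um_C : 'M[K]_N;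
  um_eq : um_R *m um_M = D *m um_C;
  um_matching : matching_mx um_M;
  um_R_unitrig : upper_unitrig um_R;
  um_C_unitrig : upper_unitrig um_C
}.

(* [None] exactly when column [c] of [R] is zero. *)
Definition low (K : fieldType) (N : nat) (R : 'M[K]_N) (c : 'I_N) :
    option 'I_N :=
  [pick r : 'I_N | (R r c != 0) &
     [forall r' : 'I_N, (R r' c != 0) ==> (r' <= r)%N]].

Definition reduced (K : fieldType) (N : nat) (R : 'M[K]_N) : Prop :=
  forall c c' : 'I_N, c != c' -> col c R != 0 -> col c' R != 0 ->
    low R c != low R c'.

Record rightReduction (K : fieldType) (N : nat) (D : 'M[K]_N) :=
  RightReduction {
  rr_R : 'M[K]_N;
  rr_V : 'M[K]_N;
  rr_eq : rr_R = D *m rr_V;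
  rr_V_unit : rr_V \in unitmx;
  rr_V_upper : upper_trig rr_V;
  rr_reduced : reduced rr_R
}.

(* The index [i] selected below is unique because [rr_R Y] is reduced. *)
Definition ebasis (K : fieldType) (N : nat) (D : 'M[K]_N)
    (Y : rightReduction D) : 'M[K]_N :=
  \matrix_(k, j) if [pick i : 'I_N | low (rr_R Y) i == Some j] is Some i
                 then rr_R Y k i else rr_V Y k j.

Section UMatchReduction.

Variables (K : fieldType) (N : nat).
Implicit Types (A M R : 'M[K]_N).

Lemma upper_trigP A :
  upper_trig A <-> (forall i j : 'I_N, (j < i)%N -> A i j = 0).
Proof.
split=> [/is_trig_mxP h i j ji|h]; first by have := h j i ji; rewrite mxE.
by apply/is_trig_mxP => i j ij; rewrite mxE h.
Qed.

Lemma upper_unitrig_unit A : upper_unitrig A -> A \in unitmx.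
Proof.
case=> tA dA; rewrite unitmxE -det_tr det_trig // big1 ?unitr1 // => i _.
by rewrite mxE dA.
Qed.

Lemma low_col_neq0 R c : col c R != 0 -> exists r, low R c = Some r.
Proof.
move=> nz; rewrite /low; case: pickP => [r _|none]; first by exists r.
have [i nzi] : exists i : 'I_N, R i c != 0.
  apply/existsP; apply: contraNT nz; rewrite negb_exists => /forallP h.
  by apply/eqP/colP => i; rewrite !mxE; apply/eqP/negPn/h.
case: (arg_maxnP (fun i : 'I_N => i : nat) (nzi : (fun i => R i c != 0) i)).
move=> r nzr maxr; have /negP[] := negbT (none r).
by rewrite nzr; apply/forallP => r'; apply/implyP/maxr.
Qed.

Lemma low_unitrig_matching R M c r :
  upper_unitrig R -> matching_mx M -> low (R *m M) c = Some r -> M r c != 0.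
Proof.
move=> [/upper_trigP tR dR] [_ uM]; rewrite /low.
case: pickP => // r0 /andP[nz /forallP maxr] [<-].
have [i nzi] : exists i : 'I_N, M i c != 0.
  apply/existsP; apply: contraNT nz; rewrite negb_exists => /forallP h.
  by rewrite mxE big1 // => i _; move/negPn/eqP: (h i) => ->; rewrite mulr0.
have RME k : (R *m M) k c = R k i * M i c.
  rewrite mxE (bigD1 i) //= big1 ?addr0 // => j ji.
  have [->|nzj] := eqVneq (M j c) 0; first by rewrite mulr0.
  by rewrite (uM _ _ _ nzj nzi) eqxx in ji.
have le1 : (i <= r0)%N by apply: (implyP (maxr i)); rewrite RME dR mul1r.
have le2 : (r0 <= i)%N.
  by rewrite leqNgt; apply: contra nz => lt; rewrite RME tR ?mul0r.
by have -> : r0 = i by apply/val_inj/eqP; rewrite eqn_leq le1 le2.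
Qed.

Lemma umatch_reduced R M :
  upper_unitrig R -> matching_mx M -> reduced (R *m M).
Proof.
move=> uR mM c c' cc' /low_col_neq0[r er] /low_col_neq0[r' er'].
apply: contra cc'; rewrite er er' => /eqP[rr']; move: er'; rewrite -rr' => er'.
have nz := low_unitrig_matching uR mM er.
have nz' := low_unitrig_matching uR mM er'.
by rewrite (mM.1 _ _ _ nz nz').
Qed.

End UMatchReduction.

Definition umatch_reduction (K : fieldType) (N : nat) (D : 'M[K]_N)
    (U : umatch D) : rightReduction D :=
  {| rr_R := um_R U *m um_M U;
     rr_V := um_C U;
     rr_eq := um_eq U;
     rr_V_unit := upper_unitrig_unit (um_C_unitrig U);
     rr_V_upper := (um_C_unitrig U).1;
     rr_reduced := umatch_reduced (um_R_unitrig U) (um_matching U) |}.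

Section Saecular.

Variables (K : fieldType) (N : nat) (C : filteredComplex K N).

Definition basis_chain (i : 'I_N) : 'cV[K]_N := delta_mx i 0.

Definition filt (p : nat) : {vspace 'cV[K]_N} :=
  (\sum_(i < N | (i < p)%N) <[basis_chain i]>)%VS.

Definition chains (n : int) : {vspace 'cV[K]_N} :=
  (\sum_(i < N | sdim C i == n) <[basis_chain i]>)%VS.

Definition filt_chains (p : nat) (n : int) : {vspace 'cV[K]_N} :=
  (filt p :&: chains n)%VS.

Definition bd_map : 'End('cV[K]_N) := linfun (mulmx (bd C)).

Inductive saecular : {vspace 'cV[K]_N} -> Prop :=
| saecular_filt p n : saecular (filt_chains p n)
| saecular_im p n : saecular (bd_map @: filt_chains p n)%VS
| saecular_preim p n : saecular (bd_map @^-1: filt_chains p n)%VS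
| saecular_add U W : saecular U -> saecular W -> saecular (U + W)%VS
| saecular_cap U W : saecular U -> saecular W -> saecular (U :&: W)%VS.

End Saecular.

(* Main.v *)
Require Import Defs.
From HB Require Import structures.
From mathcomp Require Import all_boot all_order all_algebra.

Set Implicit Arguments.
Unset Strict Implicit.
Unset Printing Implicit Defensive.

Import Order.TTheory GRing.Theory Num.Theory.
Local Open Scope ring_scope.

(** Write [E] for the matrix [ebasis Y] and [D] for the boundary.  Since
    [D *m D = 0], [D] kills the columns of [E] taken from [R], and it sends a
    column taken from [V] to a column of [R], which is zero or again a column
    of [E]; hence [D *m E = E *m T] for a matching matrix [T].  The subspaces
    spanned by columns of [E] are therefore stable under direct and inverse
    image by [D], and they form a lattice because [E] is invertible.  They
    contain the [F_p C] and the [C_n], because [E] is upper triangular and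
    0-graded. *)

(** * Subspaces spanned by columns of an invertible matrix *)

Section AdaptedSubspaces.

Variables (K : fieldType) (N : nat).
Implicit Types (E D T : 'M[K]_N) (v : 'cV[K]_N) (U W : {vspace 'cV[K]_N}).

Lemma mulmx_sum_col E v : E *m v = \sum_j v j 0 *: col j E.
Proof.
by apply/colP => i; rewrite mxE summxE; apply: eq_bigr => j _;
  rewrite !mxE mulrC.
Qed.

(* Equivalent, for invertible [E], to [W] being spanned by columns of [E], but
   stated without choosing a set of columns. *)
Definition adapted E W : Prop :=
  forall v j, E *m v \in W -> v j 0 != 0 -> col j E \in W.

Lemma free_cols E : E \in unitmx -> free [seq col j E | j <- enum 'I_N].
Proof.
move=> uE.
have -> : [seq col j E | j <- enum 'I_N] = [tuple col j E | j < N] by [].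
apply/freeP => k k0 i.
have : E *m (\col_j k j) = 0.
  rewrite mulmx_sum_col -[RHS]k0; apply: eq_bigr => j _.
  by rewrite -tnth_nth tnth_mktuple mxE.
by move/(canRL (mulKmx uE)); rewrite mulmx0 => /colP/(_ i); rewrite !mxE.
Qed.

(** Listing the columns indexed by [S] first merely permutes the free family of all columns, and an
    initial part of a free family is free. *)
Lemma free_cols_in E (S : {pred 'I_N}) :
  E \in unitmx -> free [seq col j E | j in S].
Proof.
move=> uE; have perm_enum :
    perm_eq (enum 'I_N) ([seq j <- enum 'I_N | j \in S] ++
                         [seq j <- enum 'I_N | j \notin S]).
  by rewrite perm_sym; apply/permPl; apply: perm_filterC.
have := free_cols uE; rewrite (perm_free (perm_map _ perm_enum)) map_cat.
by move/catl_free; rewrite [X in map _ (filter _ X)]enumT.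
Qed.

(** All the columns that lie in [W] serve: when a vector of [W] is expanded in the columns of [E],
    only such columns get a nonzero coefficient. *)
Lemma adapted_basis E W : E \in unitmx -> adapted E W ->
  exists J : {set 'I_N}, basis_of W [seq col j E | j in J].
Proof.
move=> uE aW; exists [set j | col j E \in W].
rewrite /basis_of free_cols_in // andbT eqEsubv; apply/andP; split.
  by apply/span_subvP => w /imageP[j + ->]; rewrite inE.
apply/subvP => w; rewrite -[w](mulKVmx uE) => wW.
rewrite mulmx_sum_col memv_suml // => j _.
have [->|nz] := eqVneq ((invmx E *m w) j 0) 0; first by rewrite scale0r mem0v.
by rewrite memvZ // memv_span // image_f // inE (aW _ _ wW nz).
Qed.

Lemma adapted_span E (S : {pred 'I_N}) : E \in unitmx ->
  adapted E <<[seq col j E | j in S]>>%VS.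
Proof.
move=> uE v j; rewrite span_def big_image /= => /memv_sumP[w wE Ev] nzj.
have [jS|jS] := boolP (j \in S); first by
  rewrite -big_image -span_def memv_span ?image_f.
(* For [j] outside [S], each summand has coordinates proportional to some [delta_mx i 0] with [i] in
   [S], so coordinate [j] of [v] vanishes. *)
case/negP: nzj.
have -> : v = \sum_(i in S) invmx E *m w i by rewrite -mulmx_sumr -Ev mulKmx.
rewrite summxE big1 // => i iS; have /vlineP[k ->] := wE i iS.
have -> : invmx E *m (k *: col i E) = k *: delta_mx i 0.
  by rewrite -scalemxAr colE mulKmx.
by rewrite !mxE; case: eqP jS => [->|]; rewrite ?iS ?mulr0.
Qed.

(** If a sum has a nonzero coordinate along a column of [E], so does one of its two terms. *)
Lemma adapted_add E U W : E \in unitmx ->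
  adapted E U -> adapted E W -> adapted E (U + W)%VS.
Proof.
move=> uE aU aW v j /memv_addP[u uU [w wW Ev]] nzj.
have vE : v = invmx E *m u + invmx E *m w by rewrite -mulmxDr -Ev mulKmx.
have [uj0|nzu] := eqVneq ((invmx E *m u) j 0) 0.
  apply: (subvP (addvSr U W)); apply: (aW (invmx E *m w)).
    by rewrite mulKVmx.
  by move: nzj; rewrite vE mxE uj0 add0r.
by apply: (subvP (addvSl U W)); apply: (aU (invmx E *m u)) nzu; rewrite mulKVmx.
Qed.

Lemma adapted_cap E U W :
  adapted E U -> adapted E W -> adapted E (U :&: W)%VS.
Proof.
move=> aU aW v j /memv_capP[vU vW] nzj.
by rewrite memv_cap (aU _ _ vU nzj) (aW _ _ vW nzj).
Qed.

Lemma matching_col E D T i j : matching_mx T -> D *m E = E *m T ->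
  T i j != 0 -> D *m col j E = T i j *: col i E.
Proof.
move=> [_ uT] DE nz; rewrite colE mulmxA DE -mulmxA -colE mulmx_sum_col.
rewrite (bigD1 i) //= big1 ?addr0 ?mxE // => k ki; rewrite mxE.
have [->|nzk] := eqVneq (T k j) 0; first by rewrite scale0r.
by rewrite (uT _ _ _ nzk nz) eqxx in ki.
Qed.

(** In the basis [E] the map [D] acts as [T]. A nonzero coordinate [i] of an image therefore comes
    from some nonzero coordinate [j] with [T i j != 0], and then [D] sends column [j] to a nonzero
    multiple of column [i]. *)
Lemma adapted_im E D T W : E \in unitmx -> matching_mx T ->
  D *m E = E *m T -> adapted E W -> adapted E (linfun (mulmx D) @: W)%VS.
Proof.
move=> uE mT DE aW v i /memv_imgP[w wW]; rewrite lfunE /= => Ev nzi.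
have vE : v = T *m (invmx E *m w).
  by rewrite -[LHS](mulKmx uE) Ev mulmxA -{1}[T](mulKmx uE) -DE -!mulmxA mulKVmx.
have [j nzj] : exists j, T i j * (invmx E *m w) j 0 != 0.
  apply/existsP; apply: contraNT nzi; rewrite negb_exists => /forallP h.
  by rewrite vE mxE big1 // => j _; apply/eqP/negPn/h.
move: nzj; rewrite mulf_eq0 negb_or => /andP[nzT nzw].
have EjW : col j E \in W by apply: aW nzw; rewrite mulKVmx.
have -> : col i E = linfun (mulmx D) ((T i j)^-1 *: col j E).
  by rewrite lfunE /= -scalemxAr (matching_col mT DE nzT) scalerK.
by rewrite memv_img // memvZ.
Qed.

(** Either column [j] of [T] is zero and [D] kills column [j] of [E], or [T i j != 0] for some [i].
    In the latter case row [i] of [T] has no other nonzero entry, so nothing cancels the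
    contribution of [v j 0] to coordinate [i] of [T *m v]. *)
Lemma adapted_preim E D T W : matching_mx T ->
  D *m E = E *m T -> adapted E W -> adapted E (linfun (mulmx D) @^-1: W)%VS.
Proof.
move=> mT DE aW v j; rewrite -!memv_preim !lfunE /= mulmxA DE -mulmxA => TvW nzj.
have [/existsP[i nzi]|/existsPn T0] := boolP [exists i, T i j != 0]; last first.
  rewrite colE mulmxA DE -mulmxA -colE (_ : col j T = 0) ?mulmx0 ?mem0v //.
  by apply/colP => i; rewrite !mxE; apply/eqP/negPn/T0.
rewrite (matching_col mT DE nzi) memvZ //; apply: aW TvW _.
rewrite mxE (bigD1 j) //= big1 ?addr0 ?mulf_neq0 // => k kj.
have [->|nzk] := eqVneq (T i k) 0; first by rewrite mul0r.
by rewrite (mT.1 _ _ _ nzk nzi) eqxx in kj.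
Qed.

(** The columns of [E] indexed by [S] are supported in [S], so their span lies in the coordinate
    subspace; both have the cardinality of [S] as dimension. *)
Lemma adapted_coord E (S : {pred 'I_N}) : E \in unitmx ->
  (forall i j, E i j != 0 -> j \in S -> i \in S) ->
  adapted E (\sum_(i in S) <[basis_chain K i]>)%VS.
Proof.
move=> uE ES.
have coordE : (\sum_(i in S) <[basis_chain K i]>)%VS =
    <<[seq col i (1%:M : 'M[K]_N) | i in S]>>%VS.
  by rewrite span_def big_image; apply: eq_bigr => i _; rewrite colE mul1mx.
suff -> : (\sum_(i in S) <[basis_chain K i]>)%VS =
    <<[seq col j E | j in S]>>%VS by apply: adapted_span.
apply/esym/eqP; rewrite eqEdim; apply/andP; split.
  apply/span_subvP => w /imageP[j jS ->].
  rewrite -[col j E]mul1mx mulmx_sum_col coordE memv_suml // => i _.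
  have [->|nz] := eqVneq (col j E i 0) 0; first by rewrite scale0r mem0v.
  by rewrite mxE in nz; rewrite memvZ // memv_span // image_f // (ES i j).
rewrite coordE (eqP (free_cols_in S (unitmx1 _ _))).
by rewrite (eqP (free_cols_in S uE)) !size_image.
Qed.

End AdaptedSubspaces.

(** * The matrix [E] of a right-reduction and the action of [D] on its columns *)

Section ReductionBasis.

Variables (K : fieldType) (N : nat).

Lemma low_Some (R : 'M[K]_N) c r : low R c = Some r ->
  R r c != 0 /\ forall r' : 'I_N, R r' c != 0 -> (r' <= r)%N.
Proof.
rewrite /low; case: pickP => // r0 /andP[nz /forallP maxr] [<-].
by split=> // r' /(implyP (maxr r')).
Qed.

Lemma upper_trig_unit (A : 'M[K]_N) : upper_trig A ->
  A \in unitmx = [forall i, A i i != 0].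
Proof.
move=> tA; rewrite unitmxE -det_tr det_trig // unitfE prodf_seq_neq0.
apply/allP/forallP => [h i|h i _]; last by rewrite mxE h.
by have := h i (mem_index_enum i); rewrite mxE.
Qed.

Variables (D : 'M[K]_N) (Y : rightReduction D).
Let R := rr_R Y.
Let V := rr_V Y.
Let E := ebasis Y.

Lemma low_inj i i' r : low R i = Some r -> low R i' = Some r -> i = i'.
Proof.
have nz c : low R c = Some r -> col c R != 0.
  move=> /low_Some[nzr _]; apply: contraNneq nzr => /colP/(_ r).
  by rewrite !mxE => ->.
move=> li li'; apply/eqP; case: eqVneq => // ii'.
by have := rr_reduced ii' (nz _ li) (nz _ li'); rewrite -/R li li' eqxx.
Qed.

(** The boolean index lets one case analysis settle both the column of [E] and the matching test in
    [ebasis_matching]. *)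
Variant ebasis_col_spec (j : 'I_N) : 'cV[K]_N -> bool -> Prop :=
| EbasisLow i of low R i = Some j : ebasis_col_spec j (col i R) true
| EbasisNotLow of (forall i, low R i != Some j) :
    ebasis_col_spec j (col j V) false.

Lemma ebasis_colP j :
  ebasis_col_spec j (col j E) [exists i, low R i == Some j].
Proof.
have [i /eqP ei|no] := pickP (fun i => low R i == Some j).
  have -> : col j E = col i R.
    apply/colP => k; rewrite !mxE.
    case: pickP => [i' /eqP ei'|/(_ i)]; last by rewrite -/R ei eqxx.
    by rewrite (low_inj ei' ei).
  have -> : [exists i, low R i == Some j] by apply/existsP; exists i; apply/eqP.
  by left.
have -> : col j E = col j V.
  by apply/colP => k; rewrite !mxE; case: pickP => // i; rewrite -/R no.
have -> : [exists i, low R i == Some j] = false.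
  by apply/existsP => -[i]; rewrite no.
by right=> i; rewrite no.
Qed.

Lemma ebasis_upper : upper_trig E.
Proof.
apply/upper_trigP => i j ji; have -> : E i j = col j E i 0 by rewrite [RHS]mxE.
case: ebasis_colP => [c /low_Some[_ maxc]|_]; rewrite mxE.
  by apply: contraTeq ji => /maxc; rewrite -leqNgt.
by have /upper_trigP -> := rr_V_upper Y.
Qed.

(** Each diagonal entry is either the lowest nonzero entry of a column of [R] or a diagonal entry of
    the invertible triangular [V]. *)
Lemma ebasis_unit : E \in unitmx.
Proof.
rewrite (upper_trig_unit ebasis_upper); apply/forallP => j.
have -> : E j j = col j E j 0 by rewrite [RHS]mxE.
case: ebasis_colP => [c /low_Some[nz _]|_]; rewrite mxE //.
by have := rr_V_unit Y; rewrite (upper_trig_unit (rr_V_upper Y)) => /forallP.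
Qed.

(** The matrix of [D] in the basis [E] when [D] squares to zero. Its nonzero entries are 1 because
    [low R j = Some i] makes column [i] of [E] equal to column [j] of [R]. *)
Definition ebasis_matching : 'M[K]_N :=
  \matrix_(i, j)
    ((low R j == Some i) && ~~ [exists c, low R c == Some j])%:R.

Lemma ebasis_matchingP : matching_mx ebasis_matching.
Proof.
have nzP i j : ebasis_matching i j != 0 -> low R j = Some i.
  by rewrite mxE; case: (low R j =P Some i); rewrite ?eqxx.
split=> [i j j' /nzP lj /nzP|i i' j /nzP lj /nzP]; first exact: low_inj.
by rewrite lj => -[].
Qed.

Lemma bd_ebasis : D *m D = 0 -> D *m E = E *m ebasis_matching.
Proof.
move=> DD; have DV : D *m V = R by rewrite -rr_eq.
suff DE j : col j (D *m E) = col j (E *m ebasis_matching).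
  by apply/matrixP => i j; have /colP/(_ i) := DE j; rewrite ![col _ _ _ _]mxE.
rewrite !colE -!mulmxA -!colE [RHS]mulmx_sum_col.
under eq_bigr do rewrite 2!mxE.
case: (ebasis_colP j) => [c _|_] /=.
  rewrite big1 => [|i _]; last by rewrite andbF scale0r.
  by rewrite colE mulmxA -DV mulmxA DD !mul0mx.
rewrite colE mulmxA DV -colE.
have [R0|/low_col_neq0[r lr]] := eqVneq (col j R) 0.
  rewrite big1 // => i _; case: eqP => [/low_Some[nz _]|_]; last exact: scale0r.
  by case/eqP: nz; have /colP/(_ i) := R0; rewrite !mxE.
rewrite lr (bigD1 r) //= eqxx scale1r big1 ?addr0 => [|i ir].
  (* Column [r] of [E] is a column of [R] with lowest index [r]; injectivity of [low] identifies it
     as column [j]. *)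
  case: ebasis_colP => [c lc|/(_ j)]; last by rewrite lr eqxx.
  by rewrite (low_inj lr lc).
by rewrite andbT (_ : Some r == Some i = false) ?scale0r // eq_sym; apply/negbTE.
Qed.

End ReductionBasis.

(** * Grading of [E] and adaptedness of the saecular lattice *)

Section SaecularBasis.

Variables (K : fieldType) (N : nat) (C : filteredComplex K N).
Variable Y : rightReduction (bd C).
Hypothesis gV : zero_graded (sdim C) (rr_V Y).

Lemma reduction_degree i j : rr_R Y i j != 0 -> sdim C i = sdim C j - 1.
Proof.
rewrite rr_eq mxE => nz.
have [k] : exists k, bd C i k * rr_V Y k j != 0.
  apply/existsP; apply: contraNT nz; rewrite negb_exists => /forallP h.
  by rewrite big1 // => k _; apply/eqP/negPn/h.
by rewrite mulf_eq0 negb_or => /andP[/bd_deg -> /gV ->].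
Qed.

(** A column of [R] is homogeneous, and it is placed at the index [j] of one of its nonzero entries,
    so its degree is that of [j]. *)
Lemma ebasis_graded : zero_graded (sdim C) (ebasis Y).
Proof.
move=> i j; have -> : ebasis Y i j = col j (ebasis Y) i 0 by rewrite [RHS]mxE.
case: ebasis_colP => [c /low_Some[/reduction_degree dj _]|_]; rewrite mxE.
  by move/reduction_degree; rewrite dj.
exact: gV.
Qed.

Lemma saecular_adapted W : saecular C W -> adapted (ebasis Y) W.
Proof.
have uE := ebasis_unit Y; have mT := ebasis_matchingP Y.
have DE := bd_ebasis Y (bd_sq0 C).
have adapted_filt p n : adapted (ebasis Y) (filt_chains C p n).
  (* Both factors are coordinate subspaces: triangularity of [E] handles the indices below [p], the
     grading those of dimension [n]. *)
  apply: adapted_cap; apply: adapted_coord => // i j nz.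
    apply: leq_ltn_trans; rewrite leqNgt; apply: contra nz => ji.
    by have /upper_trigP -> := ebasis_upper Y.
  by rewrite !unfold_in /= (ebasis_graded nz).
elim=> {W} [p n|p n|p n|U W _ aU _ aW|U W _ aU _ aW].
- exact: adapted_filt.
- exact: adapted_im mT DE (adapted_filt p n).
- exact: adapted_preim mT DE (adapted_filt p n).
- exact: adapted_add.
- exact: adapted_cap.
Qed.

End SaecularBasis.

Theorem mainTheorem5 (K : fieldType) (N : nat) (C : filteredComplex K N)
    (U : umatch (bd C)) (hR : zero_graded (sdim C) (um_R U))
    (hC : zero_graded (sdim C) (um_C U)) (W : {vspace 'cV[K]_N})
    (hW : saecular C W) :
  exists J : {set 'I_N},
    basis_of W [seq col j (ebasis (umatch_reduction U)) | j in J].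
Proof.
apply: adapted_basis; first exact: ebasis_unit.
exact: (saecular_adapted (Y := umatch_reduction U)).
Qed.
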